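(* Let $1\le k\le m$ and let $A<B$, where $A=-\infty$ or $B=\infty$ are allowed. Suppose that the $k$-th component $y_k$ of the solution of $y'(t)=f(y(t))$, $y(t_0)=\tilde y$, is monotone increasing on $[t_0,T]$ whenever all components of $\tilde y$ lie in $(A,B)$. Assume that: (i) there is a constant $B_{FE}>0$ such that for every step size $0<\Delta t_{FE}\le B_{FE}$ the forward Euler method preserves the monotone increase, i.e. for every $v^0\in\mathbb{R}^m$ with $v^0_k\in(A,B)$, the vector $v^1=v^0+\Delta t_{FE}\,f(v^0)$ satisfies $v^1_k\ge v^0_k$ and $v^1_k\in(A,B)$; (ii) the starting values of the nonstandard multistep method $$u^{n+1}=\sum_{j=1}^s\left(\tilde\alpha_j u^{n+1-j}+\varphi(\Delta t)\,\tilde\beta_j f(u^{n+1-j})\right)$$ satisfy $u^0_k,u^1_k,\dots,u^{s-1}_k\in(A,B)$; (iii) $\varphi(x)\le\mathcal{C}B_{FE}$ for all $x\ge0$, where $\mathcal{C}=\min_j\tilde\alpha_j/\tilde\beta_j\in\mathbb{R}^+$ is the SSP coefficient. Then for every step size $\Delta t\ge0$ the nonstandard multistep method satisfies $$\min_{\ell=n-s+1,\;n-s+2,\;\dots,\;n}\{u^\ell_k\}\le u^{n+1}_k\qquad\text{for all }n=s,\dots,\mathcal{N}.$$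
   Context: Here $f:\mathbb{R}^m\to\mathbb{R}^m$, $\tilde y\in\mathbb{R}^m$, and the initial value problem is assumed to have a unique solution $y=(y_1,\dots,y_m)^T$ on $[t_0,T]$. ''Monotone increasing'' is in the weak sense. The sequence $u^n=(u^n_1,\dots,u^n_m)^T$ is produced by the $s$-step explicit recursion in (ii), with $u^0=\tilde y$, continued for all indices appearing in the conclusion; $\mathcal{N}$ is the index of the last time step of the grid. The coefficients satisfy $\tilde\alpha_j,\tilde\beta_j\ge0$, and $\tilde\alpha_j=0$ implies $\tilde\beta_j=0$; the underlying standard method (with $\varphi(\Delta t)$ replaced by $\Delta t$) is consistent, in particular $\sum_{j=1}^s\tilde\alpha_j=1$. The function $\varphi$ is a nonnegative real-valued function of one variable. In $\min_j\tilde\alpha_j/\tilde\beta_j$ the minimum is over indices with $\tilde\beta_j>0$ (at least one exists). *)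

(* Defs.v *)
From HB Require Import structures.
From mathcomp Require Import all_boot all_order all_algebra.
From mathcomp Require Import all_classical all_reals all_analysis.

Set Implicit Arguments.
Unset Strict Implicit.
Unset Printing Implicit Defensive.

Import Order.TTheory GRing.Theory Num.Theory.
Import numFieldNormedType.Exports.

Local Open Scope classical_set_scope.
Local Open Scope ring_scope.

(* The derivative is the limit of difference quotients taken inside [t0, T],
   hence one-sided at the end points; values of y outside [t0, T] are
   irrelevant. *)
Definition ivp_solution (R : realType) (m : nat) (f : 'cV[R]_m -> 'cV[R]_m)
    (t0 T : R) (yt : 'cV[R]_m) (y : R -> 'cV[R]_m) : Prop :=
  y t0 = yt /\
  forall t : R, t0 <= t <= T ->
    (x - t)^-1 *: (y x - y t) @[x --> within [set` `[t0, T]] (t^')] --> f (y t).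

Definition unique_ivp_solution (R : realType) (m : nat)
    (f : 'cV[R]_m -> 'cV[R]_m) (t0 T : R) (yt : 'cV[R]_m)
    (y : R -> 'cV[R]_m) : Prop :=
  ivp_solution f t0 T yt y /\
  forall z : R -> 'cV[R]_m, ivp_solution f t0 T yt z ->
    forall t : R, t0 <= t <= T -> z t = y t.

(* Membership in the possibly unbounded open interval (A, B). *)
Definition in_range (R : realType) (A B : \bar R) (x : R) : Prop :=
  (A < x%:E < B)%E.

Definition forward_euler (R : realType) (m : nat) (f : 'cV[R]_m -> 'cV[R]_m)
    (dt : R) (v : 'cV[R]_m) : 'cV[R]_m :=
  v + dt *: f v.

(* One step u^{n+1} of the explicit s-step method.  The ordinal j < s stands
   for the index j + 1 in {1, ..., s}: alpha j is the coefficient of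
   u^{n+1-(j+1)}.  The subtraction does not truncate when s <= n + 1.
   The scalar h is phi(dt) for the nonstandard method, and dt for the
   underlying standard one. *)
Definition multistep (R : realType) (m s : nat) (f : 'cV[R]_m -> 'cV[R]_m)
    (alpha beta : 'I_s -> R) (h : R) (u : nat -> 'cV[R]_m) (n : nat)
    : 'cV[R]_m :=
  \sum_(j < s) (alpha j *: u (n.+1 - j.+1)%N
                + (h * beta j) *: f (u (n.+1 - j.+1)%N)).

(* Consistency of the standard method: for every C^1 function y, the local
   truncation error, i.e. the residual of the exact values y(t - (j+1) h)
   divided by h, tends to 0 with the step size. *)
Definition truncation_error (R : realType) (s : nat) (alpha beta : 'I_s -> R)
    (y : R -> R) (t h : R) : R :=
  (y t - \sum_(j < s) (alpha j * y (t - j.+1%:R * h)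
                       + h * beta j * derive1 y (t - j.+1%:R * h))) / h.

Definition consistent (R : realType) (s : nat) (alpha beta : 'I_s -> R)
    : Prop :=
  forall y : R -> R,
    (forall t : R, derivable y t 1) -> continuous (derive1 y) ->
    forall t : R,
      truncation_error alpha beta y t h @[h --> 0^'+] --> (0 : R).

Definition is_ssp_coefficient (R : realType) (s : nat)
    (alpha beta : 'I_s -> R) (C : R) : Prop :=
  let ratios := [set alpha j / beta j | j in [set j | 0 < beta j]] in
  ratios C /\ lbound ratios C.

(* Main.v *)
(** Consistency forces the weights [alpha] to sum to 1.  With
    [tau j = phi(dt) beta j / alpha j], the step then reads

      u^{n+1} = \sum_j alpha j (u^{n+1-j} + tau j f(u^{n+1-j})),

    a weighted average of forward Euler steps whose sizes satisfy
    [tau j <= BFE] because [phi <= C BFE] and [C <= alpha j / beta j].  The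
    [k]-th component of each Euler step stays in (A, B) and dominates that of
    the value it starts from, and an average lies between two of its terms. *)

Require Import Defs.
From HB Require Import structures.
From mathcomp Require Import all_boot all_order all_algebra.
From mathcomp Require Import all_classical all_reals all_analysis.
From mathcomp Require Import ring zify.

Set Implicit Arguments.
Unset Strict Implicit.
Unset Printing Implicit Defensive.

Import Order.TTheory GRing.Theory Num.Theory.
Import numFieldNormedType.Exports.

Local Open Scope classical_set_scope.
Local Open Scope ring_scope.

(** Tested on the constant function 1, the truncation error is [(1 - \sum_j alpha j) / h].
    Multiplied by [h] it still tends to 0, while the product is constant for [h != 0]. *)
Lemma consistent_sum1 (R : realType) (s : nat) (alpha beta : 'I_s -> R) :
  consistent alpha beta -> \sum_j alpha j = 1.
Proof.
move=> /(_ (cst 1)) cons.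
have : truncation_error alpha beta (cst 1) 0 h @[h --> 0^'+] --> (0 : R).
  apply: cons => t; first exact: derivable_cst.
  rewrite (_ : derive1 _ = cst 0); first exact: cvg_cst.
  by apply/funext => x; rewrite derive1_cst.
have h_to0 : h @[h --> (0 : R)^'+] --> (0 : R) by exact: cvg_at_right_filter.
move=> /cvgM /(_ h_to0); rewrite mulr0 => prod_to0.
apply/esym/eqP; rewrite -subr_eq0; apply/eqP.
apply: (cvg_unique _ _ prod_to0) => //.
apply: (@cvg_trans _ (cst (1 - \sum_j alpha j) @ (0 : R)^'+));
  last exact: cvg_cst.
apply: near_eq_cvg; near=> h.
have h_neq0 : h != 0 by apply: lt0r_neq0; near: h; exact: nbhs_right_gt.
rewrite /= /truncation_error divfK //; congr (_ - _).
by apply: eq_bigr => j _; rewrite derive1_cst mulr0 addr0 mulr1.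
Unshelve. all: by end_near. Qed.

(** If every [w i] exceeded the average [W], the nonnegative terms [a i * (w i - W)] would sum to 0.
    All [a i] would then vanish, against their sum being 1. *)
Lemma exists_le_wavg (R : realDomainType) (I : finType) (a w : I -> R) :
  (forall i, 0 <= a i) -> \sum_i a i = 1 ->
  exists i, w i <= \sum_j a j * w j.
Proof.
move=> a_ge0 a_sum1; set W := \sum_j _.
apply/existsP; apply: contraT => /existsPn w_gt.
have gap_gt0 i : 0 < w i - W by rewrite subr_gt0 ltNge.
have sum_gap0 : \sum_i a i * (w i - W) = 0.
  under eq_bigr do rewrite mulrBr.
  by rewrite sumrB -mulr_suml a_sum1 mul1r subrr.
have a_eq0 i : a i = 0.
  have /eqP : a i * (w i - W) = 0.
    by apply: psumr_eq0P sum_gap0 i isT => j _; rewrite mulr_ge0 // ltW.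
  by rewrite mulf_eq0 (gt_eqF (gap_gt0 i)) orbF => /eqP.
by move/eqP: a_sum1; rewrite big1 // eq_sym oner_eq0.
Qed.

Lemma exists_ge_wavg (R : realDomainType) (I : finType) (a w : I -> R) :
  (forall i, 0 <= a i) -> \sum_i a i = 1 ->
  exists i, \sum_j a j * w j <= w i.
Proof.
move=> a_ge0 a_sum1.
have [i] := exists_le_wavg (fun j => - w j) a_ge0 a_sum1.
under eq_bigr do rewrite mulrN.
by rewrite sumrN lerN2 => le_wi; exists i.
Qed.

(** Bounding the average by two actual terms treats finite and infinite [A], [B] alike. *)
Lemma in_range_wavg (R : realType) (A B : \bar R) (I : finType)
    (a w : I -> R) :
  (forall i, 0 <= a i) -> \sum_i a i = 1 -> (forall i, in_range A B (w i)) ->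
  in_range A B (\sum_i a i * w i).
Proof.
move=> a_ge0 a_sum1 w_range.
have [i le_i] := exists_le_wavg w a_ge0 a_sum1.
have [j ge_j] := exists_ge_wavg w a_ge0 a_sum1.
have /andP[gtA _] := w_range i; have /andP[_ ltB] := w_range j.
apply/andP; split; first by rewrite (lt_le_trans gtA) ?lee_fin.
by rewrite (le_lt_trans _ ltB) ?lee_fin.
Qed.

Lemma ssp_coefficient_le (R : realType) (s : nat) (alpha beta : 'I_s -> R)
    (C : R) (j : 'I_s) :
  is_ssp_coefficient alpha beta C -> 0 <= alpha j -> 0 <= beta j ->
  C * beta j <= alpha j.
Proof.
move=> [_ C_lb] a_ge0; rewrite le_eqVlt => /predU1P[<-|b_gt0].
  by rewrite mulr0.
by rewrite -ler_pdivlMr //; apply: C_lb; exists j.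
Qed.

Lemma euler_stage (R : realType) (m : nat) (k : 'I_m)
    (f : 'cV[R]_m -> 'cV[R]_m) (A B : \bar R) (BFE C a b h : R)
    (v : 'cV[R]_m) :
  (forall dt : R, 0 < dt <= BFE ->
     forall v0 : 'cV[R]_m, in_range A B (v0 k 0) ->
       v0 k 0 <= forward_euler f dt v0 k 0 /\
       in_range A B (forward_euler f dt v0 k 0)) ->
  0 <= BFE -> 0 <= a -> 0 <= b -> (a = 0 -> b = 0) -> C * b <= a ->
  0 <= h <= C * BFE -> in_range A B (v k 0) ->
  exists w, [/\ (a *: v + (h * b) *: f v) k 0 = a * w, v k 0 <= w
              & in_range A B w].
Proof.
move=> euler_incr BFE_ge0 a_ge0 b_ge0 a0_b0 Cb_le /andP[h_ge0 h_le] v_range.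
(* If [a = 0] then [tau = 0] too, by the convention [0^-1 = 0]. *)
pose tau := h * b / a; exists (forward_euler f tau v k 0).
have a_tau : h * b = a * tau.
  rewrite /tau; have [a0|a_neq0] := eqVneq a 0.
    by rewrite a0_b0 // mulr0 mul0r mulr0.
  by rewrite [RHS]mulrC divfK.
have [v_le w_range] : v k 0 <= forward_euler f tau v k 0 /\
    in_range A B (forward_euler f tau v k 0).
  (* The Euler hypothesis covers positive step sizes only; for [tau = 0] the Euler step returns [v]
     itself. *)
  have : 0 <= tau by rewrite divr_ge0 ?mulr_ge0.
  rewrite le_eqVlt => /predU1P[<-|tau_gt0].
    by rewrite /forward_euler scale0r addr0.
  apply: euler_incr => //; rewrite tau_gt0 ler_pdivrMr.
    (* [tau <= BFE] because [h * b <= C * BFE * b = BFE * (C * b) <= BFE * a]. *)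
    by rewrite (le_trans (ler_wpM2r b_ge0 h_le)) // mulrAC mulrC ler_wpM2l.
  rewrite lt0r a_ge0 andbT; apply: contraTneq tau_gt0 => a0.
  by rewrite /tau a0 invr0 mulr0 ltxx.
by split=> //; rewrite a_tau !mxE; ring.
Qed.

Theorem theorem4 (R : realType) (m : nat) (k : 'I_m)
    (f : 'cV[R]_m -> 'cV[R]_m) (yt : 'cV[R]_m) (t0 T : R)
    (y : R -> 'cV[R]_m) (A B : \bar R)
    (s : nat) (alpha beta : 'I_s -> R) (phi : R -> R) (BFE C : R)
    (t0_lt_T : t0 < T)
    (y_sol : unique_ivp_solution f t0 T yt y)
    (A_lt_B : (A < B)%E)
    (y_incr : (forall i : 'I_m, in_range A B (yt i 0)) ->
       {in `[t0, T] &, {homo (fun t => y t k 0) : a b / a <= b}})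
    (s_gt0 : (0 < s)%N)
    (alpha_ge0 : forall j, 0 <= alpha j)
    (beta_ge0 : forall j, 0 <= beta j)
    (alpha0_beta0 : forall j, alpha j = 0 -> beta j = 0)
    (cons : consistent alpha beta)
    (phi_ge0 : forall x : R, 0 <= x -> 0 <= phi x)
    (BFE_gt0 : 0 < BFE)
    (euler_incr : forall dtFE : R, 0 < dtFE <= BFE ->
       forall v0 : 'cV[R]_m, in_range A B (v0 k 0) ->
         v0 k 0 <= forward_euler f dtFE v0 k 0 /\
         in_range A B (forward_euler f dtFE v0 k 0))
    (C_ssp : is_ssp_coefficient alpha beta C)
    (C_gt0 : 0 < C)
    (phi_le : forall x : R, 0 <= x -> phi x <= C * BFE) :
  forall dt : R, 0 <= dt ->
  forall (N : nat) (u : nat -> 'cV[R]_m),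
    u 0%N = yt ->
    (forall l : nat, (l < s)%N -> in_range A B (u l k 0)) ->
    (forall n : nat, (s.-1 <= n <= N)%N ->
       u n.+1 = multistep f alpha beta (phi dt) u n) ->
    forall n : nat, (s <= n <= N)%N ->
      \big[Num.min/u n k 0]_((n - s).+1 <= l < n.+1) u l k 0 <= u n.+1 k 0.
Proof.
move=> dt dt_ge0 N u _ u_start u_step n /andP[s_le_n n_le_N].
have alpha_sum1 := consistent_sum1 cons.
(* The range of the earlier values is a premise here, so that the claim can serve inside the
   induction that establishes this range. The bound [s.-1] lets [p.+1 = s], the first computed
   index. *)
have stages p : (s.-1 <= p <= N)%N ->
    (forall l, (l <= p)%N -> in_range A B (u l k 0)) ->
    exists w : 'I_s -> R, [/\ u p.+1 k 0 = \sum_j alpha j * w j,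
      forall j : 'I_s, u (p.+1 - j.+1)%N k 0 <= w j
      & forall j, in_range A B (w j)].
  move=> p_bnd u_range.
  have /boolp.choice[w w_spec] j := euler_stage euler_incr (ltW BFE_gt0)
    (alpha_ge0 j) (beta_ge0 j) (alpha0_beta0 j)
    (ssp_coefficient_le C_ssp (alpha_ge0 j) (beta_ge0 j))
    (introT andP (conj (phi_ge0 _ dt_ge0) (phi_le _ dt_ge0)))
    (u_range (p.+1 - j.+1)%N (leq_subr _ _)).
  exists w; split=> [|j|j]; try by case: (w_spec j).
  rewrite u_step // /multistep summxE; apply: eq_bigr => j _.
  by case: (w_spec j).
(* Strong induction: indices below [s] are starting values, and any later value is an average of
   stages lying in the range. *)
have u_range l : (l <= N.+1)%N -> in_range A B (u l k 0).
  elim/ltn_ind: l => l IH l_le; have [/u_start //|s_le_l] := ltnP l s.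
  case: l => [|p] in IH l_le s_le_l *; first by rewrite leqNgt s_gt0 in s_le_l.
  have [||w [-> _ w_range]] := stages p.
  - by rewrite -ltnS (prednK s_gt0) s_le_l.
  - by move=> l l_le_p; apply: IH => //; exact: leq_trans (ltnW l_le).
  - exact: in_range_wavg.
have [||w [-> u_le_w _]] := stages n.
- by rewrite n_le_N andbT (leq_trans (leq_pred s)).
- by move=> l l_le_n; apply: u_range; rewrite (leq_trans l_le_n) ?leqW.
(* Some stage [w j] is at most the average [u n.+1 k 0], and it dominates the value at index
   [n - j]. As [j < s <= n], this index lies among those of the minimum. *)
have [j w_le] := exists_le_wavg w alpha_ge0 alpha_sum1.
apply: (@bigmin_inf_seq _ _ _ _ _ (n.+1 - j.+1)%N) => //.
  by rewrite mem_index_iota; have := ltn_ord j; lia.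
exact: le_trans (u_le_w j) w_le.
Qed.
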